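(* Let $X$ be a $C^2$ planar vector field with $X(p)=0$ and $J=DX(p)$ nilpotent of rank one. Given $q_{0}\neq0$ in $\ker J$, the Kuznetsov basis $(q_0,q_1,p_0,p_1)$ adapted to $q_0$ is determined up to $$(q_{0},q_{1},p_{0},p_{1})\mapsto(q_{0},\,q_{1}+d\,q_{0},\,p_{0}-d\,p_{1},\,p_{1}),\qquad d\in\mathbb{R},$$ and the Bogdanov--Takens coefficients $a,b$ do not depend on $d$. Replacing $q_{0}$ by $cq_{0}$, $c\neq0$, forces $(q_{1},p_{0},p_{1})\mapsto(cq_{1},c^{-1}p_{0},c^{-1}p_{1})$ and produces $(a,b)\mapsto(ca,cb)$.
   Context: A Kuznetsov basis adapted to $q_0$ is a quadruple $(q_0,q_1,p_0,p_1)$ of vectors of $\mathbb{R}^2$ with $Jq_0=0$, $Jq_1=q_0$, $J^{\top}p_1=0$, $J^{\top}p_0=p_1$, and $\langle q_0,p_0\rangle=\langle q_1,p_1\rangle=1$, $\langle q_0,p_1\rangle=\langle q_1,p_0\rangle=0$. With $B(u,v)=D^2X(p)[u,v]$, the associated Bogdanov--Takens coefficients are $a=\tfrac12\langle p_1,B(q_0,q_0)\rangle$ and $b=\langle p_0,B(q_0,q_0)\rangle+\langle p_1,B(q_0,q_1)\rangle$. *)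

(* Defs.v *)
From HB Require Import structures.
From mathcomp Require Export all_boot all_order all_algebra.
From mathcomp Require Export all_classical all_reals all_analysis.
Export Order.TTheory GRing.Theory Num.Theory.
Export numFieldNormedType.Exports.

Set Implicit Arguments.
Unset Strict Implicit.
Unset Printing Implicit Defensive.

Local Open Scope classical_set_scope.
Local Open Scope ring_scope.

(* For finite-dimensional V, continuity of x |-> 'd f x v for every v is the
   same as continuity of x |-> 'd f x in operator norm. *)
Definition C1_on (R : realType) (V W : normedModType R)
    (U : set V) (f : V -> W) : Prop :=
  (forall x, U x -> differentiable f x) /\
  (forall x v, U x -> {for x, continuous (fun y => 'd f y v)}).

(* Jacobian matrix acting on column vectors (the library's jacobian acts on
   row vectors from the right): DX(x) v = jac X x *m v. *)
Definition jac (R : realType) (X : 'cV[R]_2 -> 'cV[R]_2) (x : 'cV[R]_2) :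
    'M[R]_2 :=
  \matrix_(i, j) ('d X x (delta_mx j 0 : 'cV[R]_2) : 'cV[R]_2) i 0.

Definition C2_on (R : realType) (U : set 'cV[R]_2)
    (X : 'cV[R]_2 -> 'cV[R]_2) : Prop :=
  C1_on U X /\ C1_on U (jac X).

(* D^2 X(p)[u, v] = (D(DX)(p) u) v *)
Definition hess (R : realType) (X : 'cV[R]_2 -> 'cV[R]_2) (p u v : 'cV[R]_2) :
    'cV[R]_2 :=
  ('d (jac X) p u : 'M[R]_2) *m v.

Definition inner (R : realType) (u v : 'cV[R]_2) : R := \sum_i u i 0 * v i 0.

Definition nilpotent_mx (R : realType) (J : 'M[R]_2) : Prop :=
  exists k : nat, J ^+ k = 0.

Record quadruple (R : realType) := Quadruple {
  vq0 : 'cV[R]_2;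
  vq1 : 'cV[R]_2;
  vp0 : 'cV[R]_2;
  vp1 : 'cV[R]_2 }.

Definition kuznetsov_basis (R : realType) (J : 'M[R]_2) (q0 : 'cV[R]_2)
    (e : quadruple R) : Prop :=
  vq0 e = q0 /\
  [/\ J *m vq0 e = 0, J *m vq1 e = vq0 e,
      J^T *m vp1 e = 0 & J^T *m vp0 e = vp1 e] /\
  [/\ inner (vq0 e) (vp0 e) = 1, inner (vq1 e) (vp1 e) = 1,
      inner (vq0 e) (vp1 e) = 0 & inner (vq1 e) (vp0 e) = 0].

Definition shift_basis (R : realType) (d : R) (e : quadruple R) : quadruple R :=
  Quadruple (vq0 e) (vq1 e + d *: vq0 e) (vp0 e - d *: vp1 e) (vp1 e).

Definition scale_basis (R : realType) (c : R) (e : quadruple R) : quadruple R :=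
  Quadruple (c *: vq0 e) (c *: vq1 e) (c^-1 *: vp0 e) (c^-1 *: vp1 e).

Definition bt_a (R : realType) (X : 'cV[R]_2 -> 'cV[R]_2) (p : 'cV[R]_2)
    (e : quadruple R) : R :=
  2^-1 * inner (vp1 e) (hess X p (vq0 e) (vq0 e)).

Definition bt_b (R : realType) (X : 'cV[R]_2 -> 'cV[R]_2) (p : 'cV[R]_2)
    (e : quadruple R) : R :=
  inner (vp0 e) (hess X p (vq0 e) (vq0 e))
  + inner (vp1 e) (hess X p (vq0 e) (vq1 e)).

(* Main.v *)
(** Nilpotency and rank one give J^2 = 0 and im J = ker J, so J has a preimage
    of q0; p0 = q0 / |q0|^2, p1 = J^T p0 and a preimage q1 corrected along q0
    form a Kuznetsov basis.  In general (p0, p1) is the basis dual to (q0, q1),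
    so the vectors of a second Kuznetsov basis can be expanded in the first one;
    the coefficients are all forced except d = <p0, q1'>. *)
Require Import Defs.
From mathcomp Require Import ring.

Set Implicit Arguments.
Unset Strict Implicit.
Unset Printing Implicit Defensive.

Local Open Scope classical_set_scope.
Local Open Scope ring_scope.

Section Inner.
Variable R : realType.
Implicit Types u v w : 'cV[R]_2.

Lemma innerC u v : inner u v = inner v u.
Proof. by apply: eq_bigr => i _; rewrite mulrC. Qed.

Lemma innerDl u v w : inner (u + v) w = inner u w + inner v w.
Proof. by rewrite -big_split; apply: eq_bigr => i _; rewrite mxE mulrDl. Qed.

Lemma innerZl a u v : inner (a *: u) v = a * inner u v.
Proof. by rewrite mulr_sumr; apply: eq_bigr => i _; rewrite mxE mulrA. Qed.

Lemma innerDr u v w : inner u (v + w) = inner u v + inner u w.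
Proof. by rewrite innerC innerDl !(innerC u). Qed.

Lemma innerZr a u v : inner u (a *: v) = a * inner u v.
Proof. by rewrite innerC innerZl innerC. Qed.

Lemma innerBl u v w : inner (u - v) w = inner u w - inner v w.
Proof. by rewrite innerDl -scaleN1r innerZl mulN1r. Qed.

Lemma innerBr u v w : inner u (v - w) = inner u v - inner u w.
Proof. by rewrite innerC innerBl !(innerC u). Qed.

Lemma trmx_mul_inner u v : u^T *m v = (inner u v)%:M.
Proof.
apply/matrixP => i j; rewrite !ord1 !mxE mulr1n.
by apply: eq_bigr => k _; rewrite mxE.
Qed.

Lemma inner_mulmx (J : 'M[R]_2) u v : inner (J *m u) v = inner u (J^T *m v).
Proof.
have: (inner (J *m u) v)%:M = (inner u (J^T *m v))%:M :> 'M[R]_1.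
  by rewrite -!trmx_mul_inner trmx_mul mulmxA.
by move/matrixP/(_ 0 0); rewrite !mxE !mulr1n.
Qed.

Lemma inner_self_neq0 u : u != 0 -> inner u u != 0.
Proof.
apply: contra_neq => uu0; apply/matrixP => i j; rewrite ord1 mxE.
have := uu0; move/eqP; rewrite psumr_eq0 => [|k _]; last by rewrite -expr2 sqr_ge0.
by move/allP/(_ i (mem_index_enum _)); rewrite mulf_eq0 orbb => /eqP.
Qed.

(** The four pairings say that the square matrix with rows [w0], [w1] is a left inverse of the one
    with columns [u0], [u1]. It is then also a right inverse, and the product in that order, applied
    to [v], is the expansion. *)
Lemma biorthogonal_expansion u0 u1 w0 w1 v :
  inner u0 w0 = 1 -> inner u1 w1 = 1 -> inner u0 w1 = 0 -> inner u1 w0 = 0 ->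
  v = inner w0 v *: u0 + inner w1 v *: u1.
Proof.
move=> h00 h11 h01 h10.
have WU : (row_mx w0 w1)^T *m row_mx u0 u1 = 1%:M.
  rewrite tr_row_mx mul_col_row !trmx_mul_inner !(innerC w0) !(innerC w1).
  by rewrite h00 h11 h01 h10 !raddf0 -scalar_mx_block.
have := mulmx1C WU; rewrite tr_row_mx mul_row_col => UW.
rewrite -[LHS]mul1mx -UW mulmxDl -!mulmxA !trmx_mul_inner.
by rewrite !mul_mx_scalar.
Qed.

End Inner.

Section NilpotentRankOne.
Variables (R : realType) (J : 'M[R]_2).
Hypotheses (nilJ : nilpotent_mx J) (rankJ : \rank J = 1%N).

(** If the square were nonzero, its rank would equal that of [J], so both row spaces would agree and
    [J = D *m (J *m J)] for some [D]. Substituting this into itself puts arbitrarily high powers of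
    [J] on the right, so nilpotency would force [J = 0]. *)
Lemma nilpotent_rank1_sqr0 : J *m J = 0.
Proof.
apply/eqP; rewrite -mxrank_eq0; case: posnP => // rankJJ; exfalso.
have leJ : (\rank J <= \rank (J *m J))%N by rewrite rankJ.
have /submxP[D JE] : (J <= J *m J)%MS.
  by have [_ <-] := mxrank_leqif_sup (submxMl J J); rewrite eqn_leq leJ mxrankM_maxl.
have [k Jk0] := nilJ.
have J0 : J = 0.
  have iterJ n : J = D ^+ n * J * J ^+ n.
    elim: n => [|n IHn]; first by rewrite !expr0 mul1r mulr1.
    rewrite [LHS]IHn exprSr exprS.
    transitivity (D ^+ n * (D * (J * J)) * J ^+ n); last by rewrite !mulrA.
    by congr (_ * _ * _).
  by rewrite (iterJ k) Jk0 mulr0.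
by have := rankJ; rewrite J0 mxrank0.
Qed.

(** The image lies in the kernel because the square vanishes, and both have dimension 1. Transposes
    appear because [kermx] and [<=] on matrices refer to row vectors. *)
Lemma nilpotent_rank1_ker_im (v : 'cV[R]_2) :
  J *m v = 0 -> exists w : 'cV[R]_2, J *m w = v.
Proof.
move=> Jv0.
have subJ : (J^T <= kermx J^T)%MS.
  by apply/sub_kermxP; rewrite -trmx_mul nilpotent_rank1_sqr0 trmx0.
have : (v^T <= kermx J^T)%MS by apply/sub_kermxP; rewrite -trmx_mul Jv0 trmx0.
have kerJ : (kermx J^T <= J^T)%MS.
  by have [_ <-] := mxrank_leqif_sup subJ; rewrite mxrank_ker mxrank_tr rankJ.
move/submx_trans => /(_ _ _ kerJ) /submxP[D vE].
by exists D^T; apply: trmx_inj; rewrite vE trmx_mul trmxK.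
Qed.

End NilpotentRankOne.

Section KuznetsovBasis.
Variables (R : realType) (J : 'M[R]_2).
Implicit Types (q : 'cV[R]_2) (e : quadruple R).

Lemma kuznetsov_basis_exists q : nilpotent_mx J -> \rank J = 1%N ->
  q != 0 -> J *m q = 0 -> exists e, kuznetsov_basis J q e.
Proof.
move=> nilJ rankJ q_neq0 Jq0.
have [w Jw] := nilpotent_rank1_ker_im nilJ rankJ Jq0.
pose p0 := (inner q q)^-1 *: q.
have qp0 : inner q p0 = 1 by rewrite innerZr mulVf ?inner_self_neq0.
(* The correction makes [q1] orthogonal to [p0]; it does not change the image under [J], since [q]
   lies in the kernel. *)
pose q1 := w - inner w p0 *: q.
have Jq1 : J *m q1 = q by rewrite mulmxBr -scalemxAr Jq0 scaler0 subr0.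
exists (Quadruple q q1 p0 (J^T *m p0)).
split=> //=; split; split=> //=.
- by rewrite mulmxA -trmx_mul nilpotent_rank1_sqr0 // trmx0 mul0mx.
- by rewrite -inner_mulmx Jq1.
- by rewrite -inner_mulmx Jq0 -(scale0r q) innerZl mul0r.
- by rewrite innerBl innerZl qp0 mulr1 subrr.
Qed.

Lemma kuznetsov_basis_shift q e d :
  kuznetsov_basis J q e -> kuznetsov_basis J q (shift_basis d e).
Proof.
case: e => q0 q1 p0 p1 [/= <-] [[Jq0 Jq1 Jp1 Jp0] [h00 h11 h01 h10]].
split=> //=; split; split=> //=.
- by rewrite mulmxDr -scalemxAr Jq0 scaler0 addr0.
- by rewrite mulmxBr -scalemxAr Jp1 scaler0 subr0.
- by rewrite innerBr innerZr h00 h01 mulr0 subr0.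
- by rewrite innerDl innerZl h11 h01 mulr0 addr0.
(* The opposite signs in the shift matter here: the two surviving terms are [- d] from [inner q1 p1]
   and [d] from [inner q0 p0]. *)
- by rewrite innerDl innerZl !innerBr !innerZr h10 h11 h00 h01; ring.
Qed.

Lemma kuznetsov_basis_unique q e e' : kuznetsov_basis J q e ->
  kuznetsov_basis J q e' <-> exists d, e' = shift_basis d e.
Proof.
move=> Ke; split=> [|[d ->]]; last exact: kuznetsov_basis_shift.
case: e e' Ke => [q0 q1 p0 p1] [q0' q1' p0' p1'].
move=> [/= <-] [[Jq0 Jq1 Jp1 Jp0] [h00 h11 h01 h10]].
move=> [/= ->] [[_ Jq1' Jp1' Jp0'] [h00' h11' h01' h10']].
exists (inner p0 q1'); rewrite /shift_basis /=.
have q1E : q1' = q1 + inner p0 q1' *: q0.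
  rewrite {1}(biorthogonal_expansion q1' h00 h11 h01 h10).
  (* The coefficient of [q1] is forced: moving [J^T] across the pairing turns [inner p1 q1'] into
     [inner q0 p0], which is 1. *)
  by rewrite -Jp0 (innerC (_ *m _)) -inner_mulmx Jq1' h00 scale1r addrC.
have q1E' : q1 = q1' - inner p0 q1' *: q0 by rewrite {1}q1E addrK.
(* With the roles of the two pairs exchanged, the coordinates of [p0'] and [p1'] are their pairings
   with [q0] and [q1]; writing [q1] through [q1'] reduces these to the relations of the second
   basis. *)
have dualE v : v = inner q0 v *: p0 + inner q1 v *: p1.
  by apply: biorthogonal_expansion; rewrite innerC.
congr Quadruple => //.
- rewrite [LHS]dualE h00' scale1r q1E' innerBl innerZl h00' h10' mulr1 sub0r.
  by rewrite scaleNr.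
- rewrite [LHS]dualE h01' scale0r add0r q1E' innerBl innerZl h01' h11' mulr0.
  by rewrite subr0 scale1r.
Qed.

Lemma kuznetsov_basis_scale q e c : c != 0 ->
  kuznetsov_basis J q e -> kuznetsov_basis J (c *: q) (scale_basis c e).
Proof.
case: e => q0 q1 p0 p1 c0 [/= <-] [[Jq0 Jq1 Jp1 Jp0] [h00 h11 h01 h10]].
split=> //=; split; split; rewrite /= -?scalemxAr ?innerZl ?innerZr.
- by rewrite Jq0 scaler0.
- by rewrite Jq1.
- by rewrite Jp1 scaler0.
- by rewrite Jp0.
- by rewrite h00 mulr1 mulfV.
- by rewrite h11 mulr1 mulfV.
- by rewrite h01 !mulr0.
- by rewrite h10 !mulr0.
Qed.

End KuznetsovBasis.

Section Coefficients.
Variables (R : realType) (X : 'cV[R]_2 -> 'cV[R]_2) (p : 'cV[R]_2).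
Implicit Types (u v w : 'cV[R]_2) (e : quadruple R).

Lemma hessZl a u v : hess X p (a *: u) v = a *: hess X p u v.
Proof. by rewrite /hess linearZ /= -scalemxAl. Qed.

Lemma hessDr u v w : hess X p u (v + w) = hess X p u v + hess X p u w.
Proof. exact: mulmxDr. Qed.

Lemma hessZr a u v : hess X p u (a *: v) = a *: hess X p u v.
Proof. by rewrite /hess -scalemxAr. Qed.

Lemma bt_a_shift d e : bt_a X p (shift_basis d e) = bt_a X p e.
Proof. by []. Qed.

(** The change of [q1] adds [d] times the pairing of [p1] with B(q0, q0), and the change of [p0]
    subtracts the same quantity. *)
Lemma bt_b_shift d e : bt_b X p (shift_basis d e) = bt_b X p e.
Proof.
rewrite /bt_b /shift_basis /= hessDr hessZr innerBl innerDr innerZl innerZr.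
ring.
Qed.

(** The two arguments of the Hessian contribute the square of [c] and the covector contributes
    [c^-1], leaving one factor [c]. *)
Lemma bt_a_scale c e : c != 0 -> bt_a X p (scale_basis c e) = c * bt_a X p e.
Proof.
by move=> c0; rewrite /bt_a /= hessZl hessZr innerZl !innerZr mulKf // mulrCA.
Qed.

Lemma bt_b_scale c e : c != 0 -> bt_b X p (scale_basis c e) = c * bt_b X p e.
Proof.
move=> c0; rewrite /bt_b /= !hessZl !hessZr !innerZl !innerZr !mulKf //.
by rewrite mulrDr.
Qed.

End Coefficients.

Theorem lemma2p3 (R : realType) (U : set 'cV[R]_2)
    (X : 'cV[R]_2 -> 'cV[R]_2) (p q0 : 'cV[R]_2)
    (hU : open U) (hp : U p) (hX : C2_on U X)
    (hXp : X p = 0)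
    (hnil : nilpotent_mx (jac X p)) (hrank : \rank (jac X p) = 1%N)
    (hq0 : q0 != 0) (hker : jac X p *m q0 = 0) :
  (exists e : quadruple R, kuznetsov_basis (jac X p) q0 e) /\
  (forall e : quadruple R, kuznetsov_basis (jac X p) q0 e ->
    (forall e' : quadruple R,
       kuznetsov_basis (jac X p) q0 e' <->
       exists d : R, e' = shift_basis d e) /\
    (forall d : R,
       bt_a X p (shift_basis d e) = bt_a X p e /\
       bt_b X p (shift_basis d e) = bt_b X p e) /\
    (forall c : R, c != 0 ->
       kuznetsov_basis (jac X p) (c *: q0) (scale_basis c e) /\
       (forall e' : quadruple R,
          kuznetsov_basis (jac X p) (c *: q0) e' <->
          exists d : R, e' = shift_basis d (scale_basis c e)) /\
       (forall e' : quadruple R,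
          kuznetsov_basis (jac X p) (c *: q0) e' ->
          bt_a X p e' = c * bt_a X p e /\
          bt_b X p e' = c * bt_b X p e))).
Proof.
split; first exact: kuznetsov_basis_exists.
move=> e Ke; split; first by move=> e'; exact: kuznetsov_basis_unique.
split; first by move=> d; rewrite bt_a_shift bt_b_shift.
move=> c c0; have Kce := kuznetsov_basis_scale c0 Ke.
split=> //; split=> e'; first exact: kuznetsov_basis_unique.
(* Every basis adapted to [c *: q0] is a shift of the scaled one, so shift invariance reduces the
   claim to [scale_basis c e]. *)
move/(kuznetsov_basis_unique _ Kce) => [d ->].
by rewrite bt_a_shift bt_b_shift bt_a_scale // bt_b_scale.
Qed.
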